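(* Assume $MA(\omega_1)$. Then there is no wide Aronszajn tree which is universal under weak embeddings; that is, there is no wide Aronszajn tree $U$ such that every wide Aronszajn tree weakly embeds into $U$.
   Context: A wide Aronszajn tree is a tree of height $\omega_1$ and cardinality $\aleph_1$ with no uncountable branch. A weak embedding from $T_1$ to $T_2$ is a map $f:T_1\to T_2$ with $x<_{T_1}y\Rightarrow f(x)<_{T_2}f(y)$. $MA(\omega_1)$ is Martin's Axiom for $\aleph_1$ dense sets. *)

(* Defs.v *)
From Stdlib Require Import Classical.

Definition countable {A : Type} (P : A -> Prop) : Prop :=
  exists f : A -> nat, forall x y, P x -> P y -> f x = f y -> x = y.

Definition countableT (A : Type) : Prop := countable (fun _ : A => True).

Definition strict_wellorder {A : Type} (R : A -> A -> Prop) : Prop :=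
  (forall x, ~ R x x) /\
  (forall x y z, R x y -> R y z -> R x z) /\
  (forall x y, R x y \/ x = y \/ R y x) /\
  well_founded R.

Definition is_omega1 {W : Type} (ltW : W -> W -> Prop) : Prop :=
  strict_wellorder ltW /\ ~ countableT W /\
  (forall a : W, countable (fun b => ltW b a)).

Record sporder := { node :> Type; tlt : node -> node -> Prop }.

Definition is_tree (T : sporder) : Prop :=
  (forall x : T, ~ tlt T x x) /\
  (forall x y z : T, tlt T x y -> tlt T y z -> tlt T x z) /\
  (forall x y z : T, tlt T y x -> tlt T z x ->
      tlt T y z \/ y = z \/ tlt T z y) /\
  well_founded (tlt T).

(* ht is the height function into omega_1 = W: ht x is the order type of the
   predecessors of x (ht is strictly increasing and maps pred(x) onto
   {a | a < ht x}). *)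
Definition is_height {W : Type} (ltW : W -> W -> Prop) (T : sporder)
  (ht : T -> W) : Prop :=
  (forall x y : T, tlt T y x -> ltW (ht y) (ht x)) /\
  (forall (x : T) (a : W), ltW a (ht x) -> exists y, tlt T y x /\ ht y = a).

Definition is_chain (T : sporder) (B : T -> Prop) : Prop :=
  forall x y, B x -> B y -> tlt T x y \/ x = y \/ tlt T y x.

Definition is_branch (T : sporder) (B : T -> Prop) : Prop :=
  is_chain T B /\
  (forall C : T -> Prop, is_chain T C -> (forall x, B x -> C x) ->
     forall x, C x -> B x).

Definition wide_aronszajn {W : Type} (ltW : W -> W -> Prop) (T : sporder) : Prop :=
  is_tree T /\
  (exists ht : T -> W, is_height ltW T ht /\ forall a : W, exists x, ht x = a) /\
  (exists f : T -> W, (forall x y, f x = f y -> x = y) /\ (forall a, exists x, f x = a)) /\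
  (forall B : T -> Prop, is_branch T B -> countable B).

Definition weak_embedding (T1 T2 : sporder) (f : T1 -> T2) : Prop :=
  forall x y : T1, tlt T1 x y -> tlt T2 (f x) (f y).

Definition weakly_embeds (T1 T2 : sporder) : Prop :=
  exists f : T1 -> T2, weak_embedding T1 T2 f.

(* Forcing notions: preorders, q <= p meaning q is stronger. *)
Definition compatible {P : Type} (le : P -> P -> Prop) (p q : P) : Prop :=
  exists r, le r p /\ le r q.

Definition is_antichain {P : Type} (le : P -> P -> Prop) (A : P -> Prop) : Prop :=
  forall p q, A p -> A q -> p <> q -> ~ compatible le p q.

Definition ccc {P : Type} (le : P -> P -> Prop) : Prop :=
  forall A : P -> Prop, is_antichain le A -> countable A.

Definition dense {P : Type} (le : P -> P -> Prop) (D : P -> Prop) : Prop :=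
  forall p, exists q, le q p /\ D q.

Definition is_filter {P : Type} (le : P -> P -> Prop) (G : P -> Prop) : Prop :=
  (exists p, G p) /\
  (forall p q, G p -> le p q -> G q) /\
  (forall p q, G p -> G q -> exists r, G r /\ le r p /\ le r q).

Definition MA_omega1 {W : Type} (ltW : W -> W -> Prop) : Prop :=
  forall (P : Type) (le : P -> P -> Prop),
    inhabited P ->
    (forall p, le p p) -> (forall p q r, le p q -> le q r -> le p r) ->
    ccc le ->
    forall D : W -> P -> Prop, (forall a, dense le (D a)) ->
    exists G : P -> Prop, is_filter le G /\ forall a, exists p, G p /\ D a p.

(* Main.v *)
(** Let U be universal. Martin's axiom, applied to finite partial maps from U to
    the naturals that are injective on chains, gives c : U -> nat injective on
    chains and coherent: for u, v in U, the predecessors of u and of v at a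
    common level have the same colour at all but finitely many levels. A
    condition q extending p must give one single colour, at each new level, to
    the predecessors of the elements of the domain of p. The countable chain
    condition is Baumgartner's argument: a uniform ultrafilter on an uncountable
    family of incompatible conditions yields an uncountable chain of U.

    The traces (colour sequences below the nodes of U), ordered by extension,
    form a wide Aronszajn tree, because the colours are distinct along a chain.
    Suppose that it has a weak embedding f into U. Pick u_a in U of height a and
    z_a = f(u_a), whose trace agrees with that of u_a at all but finitely many
    ordinals below a. If the traces of u_a and u_b first differ at x, then their
    common restriction to x is a node of height x, so that its image under f
    forces z_a and z_b to have the same predecessor at x, hence the same colour
    there. Choosing a, b such that x avoids the finite sets where the traces of
    u_a and z_a, and of u_b and z_b, differ, the traces of u_a and u_b agree at x
    after all. Such a, b exist, for otherwise the traces with uncountably many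
    u_a above them would form an uncountable chain. *)

From Stdlib Require Import ClassicalEpsilon FunctionalExtensionality PropExtensionality
  List Arith Lia Cantor.
Require Import Defs.
Import ListNotations.

(** * Countable sets *)

Lemma countable_sub {A : Type} (P Q : A -> Prop) :
  (forall x, Q x -> P x) -> countable P -> countable Q.
Proof. intros H [f Hf]. exists f. intros x y Hx Hy. apply Hf; auto. Qed.

Lemma countable_rel {A : Type} (P : A -> Prop) (R : A -> nat -> Prop) :
  (forall x, P x -> exists n, R x n) ->
  (forall x y n, P x -> P y -> R x n -> R y n -> x = y) -> countable P.
Proof.
intros Hex Hinj.
assert (H : forall x, exists n, P x -> R x n).
{ intro x. destruct (classic (P x)) as [Px | nPx].
  - destruct (Hex x Px) as [n Hn]. now exists n.
  - now exists 0. }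
exists (fun x => proj1_sig (constructive_indefinite_description _ (H x))).
intros x y Px Py.
destruct (constructive_indefinite_description _ (H x)) as [n Hn].
destruct (constructive_indefinite_description _ (H y)) as [m Hm].
simpl. intros <-. exact (Hinj x y n Px Py (Hn Px) (Hm Py)).
Qed.

Lemma countable_union {I A : Type} (J : I -> Prop) (Q : I -> A -> Prop) :
  countable J -> (forall i, J i -> countable (Q i)) ->
  countable (fun x => exists i, J i /\ Q i x).
Proof.
intros [j Hj] HQ.
assert (H : forall i, exists f : A -> nat, J i ->
  forall x y, Q i x -> Q i y -> f x = f y -> x = y).
{ intro i. destruct (classic (J i)) as [Ji | nJi].
  - destruct (HQ i Ji) as [f Hf]. now exists f.
  - now exists (fun _ => 0). }
set (F i := proj1_sig (constructive_indefinite_description _ (H i))).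
assert (HF : forall i, J i -> forall x y, Q i x -> Q i y -> F i x = F i y -> x = y).
{ intro i. unfold F.
  now destruct (constructive_indefinite_description _ (H i)). }
apply countable_rel with
  (fun x n => exists i, J i /\ Q i x /\ n = Cantor.to_nat (j i, F i x)).
- intros x [i [Ji Qx]]. now exists (Cantor.to_nat (j i, F i x)), i.
- intros x y n _ _ [i [Ji [Qx ->]]] [i' [Ji' [Qy E]]].
  apply Cantor.to_nat_inj in E. injection E as E1 E2.
  apply Hj in E1; auto. subst i'. exact (HF i Ji x y Qx Qy E2).
Qed.

Lemma countable_nat (P : nat -> Prop) : countable P.
Proof. now exists (fun n => n). Qed.

Lemma countable_or {A : Type} (P Q : A -> Prop) :
  countable P -> countable Q -> countable (fun x => P x \/ Q x).
Proof.
intros HP HQ.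
apply countable_sub with
  (fun x => exists b : nat, True /\ (if b then P else Q) x).
- intros x [H | H]; [exists 0 | exists 1]; auto.
- apply (countable_union (fun _ => True) (fun b : nat => if b then P else Q)).
  + apply countable_nat.
  + now intros [|b] _.
Qed.

Lemma countable_In {A : Type} (l : list A) : countable (fun x => In x l).
Proof.
apply countable_rel with (fun x n => nth_error l n = Some x).
- intros x. apply In_nth_error.
- intros x y n _ _ Hx Hy. congruence.
Qed.

Lemma countable_eq {A : Type} (a : A) : countable (fun x => x = a).
Proof. exists (fun _ => 0). now intros x y -> ->. Qed.

Lemma countable_times_nat {A : Type} (P : A -> Prop) :
  countable P -> countable (fun e : A * nat => P (fst e)).
Proof.
intros [f Hf]. exists (fun e => Cantor.to_nat (f (fst e), snd e)).
intros [x n] [y m] Px Py E. apply Cantor.to_nat_inj in E. simpl in *.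
injection E as E1 E2. apply Hf in E1; congruence.
Qed.

Lemma uncountable_inhabited {A : Type} (P : A -> Prop) :
  ~ countable P -> exists a, P a.
Proof.
intro H. apply NNPP. intro N. apply H. exists (fun _ => 0).
intros x y Px. exfalso. eauto.
Qed.

Lemma uncountable_diff {A : Type} (P C : A -> Prop) :
  ~ countable P -> countable (fun a => P a /\ C a) ->
  ~ countable (fun a => P a /\ ~ C a).
Proof.
intros HP HC H. apply HP.
apply countable_sub with (2 := countable_or _ _ HC H).
intros x Px. destruct (classic (C x)); tauto.
Qed.

(* Replaces the Delta-system lemma: instead of being disjoint outside the root
   [d], the finite sets only contain each point outside [d] countably often. *)
Lemma root_lemma {A X : Type} (P : A -> Prop) (E : A -> list X) :
  ~ countable P ->
  exists (d : list X) (n : nat) (Q : A -> Prop),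
    ~ countable Q /\
    (forall a, Q a -> P a /\ incl d (E a) /\ length (E a) = n) /\
    (forall e, ~ In e d -> countable (fun a => Q a /\ In e (E a))).
Proof.
intro HP.
assert (Hn : exists n, ~ countable (fun a => P a /\ length (E a) = n)).
{ apply NNPP. intro N. apply HP.
  apply countable_sub with
    (fun a => exists n, True /\ (P a /\ length (E a) = n)); [eauto|].
  apply (countable_union (fun _ => True)
    (fun n a => P a /\ length (E a) = n) (countable_nat _)).
  intros n _. apply NNPP. intro. apply N. now exists n. }
destruct Hn as [n Hn].
enough (H : forall m (d : list X), NoDup d -> length d + m = n ->
  ~ countable (fun a => (P a /\ length (E a) = n) /\ incl d (E a)) ->
  exists (d : list X) (n : nat) (Q : A -> Prop),
    ~ countable Q /\
    (forall a, Q a -> P a /\ incl d (E a) /\ length (E a) = n) /\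
    (forall e, ~ In e d -> countable (fun a => Q a /\ In e (E a)))).
{ apply (H n []); [constructor | easy |]. intro C. apply Hn.
  apply countable_sub with (2 := C). intros a Ha. split; [easy | intros e []]. }
(* As long as some outside point lies in uncountably many of the sets, it is added to [d]; [m]
   counts the room left, since a list of length [n] cannot hold [n + 1] distinct points. *)
induction m as [|m IH]; intros d Hd Hlen Hunc;
  (destruct (classic (forall e, ~ In e d -> countable (fun a =>
     ((P a /\ length (E a) = n) /\ incl d (E a)) /\ In e (E a)))) as [H | H];
   [exists d, n, (fun a => (P a /\ length (E a) = n) /\ incl d (E a));
    repeat split; intuition |]);
  apply not_all_ex_not in H; destruct H as [e He];
  apply imply_to_and in He; destruct He as [He Hu];
  assert (ND : NoDup (e :: d)) by now constructor.
- exfalso. apply uncountable_inhabited in Hu.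
  destruct Hu as [a [[[_ La] Ia] Ie]].
  assert (L : length (e :: d) <= length (E a))
    by (apply NoDup_incl_length; [easy | intros z [<- | Hz]; auto]).
  simpl in L. lia.
- apply (IH (e :: d) ND); [simpl; lia |]. intro C. apply Hu.
  apply countable_sub with (2 := C). intros a [[Ha Ia] Ie].
  split; [easy | intros z [<- | Hz]; auto].
Qed.

(** With [uncountable_diff] this leaves uncountably many indices whose lists avoid [Z] outside the
    root. *)
Lemma countable_meeting {A X : Type} (d : list X) (Q : A -> Prop) (E : A -> list X)
  (Z : X -> Prop) :
  (forall e, ~ In e d -> countable (fun a => Q a /\ In e (E a))) ->
  countable Z ->
  countable (fun a => Q a /\ exists e, Z e /\ ~ In e d /\ In e (E a)).
Proof.
intros H HZ.
apply countable_sub with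
  (fun a => exists e, (Z e /\ ~ In e d) /\ (Q a /\ In e (E a))).
- intros a [Qa [e He]]. exists e. tauto.
- apply countable_union; [apply countable_sub with (2 := HZ); tauto |].
  intros e [_ He]. auto.
Qed.

(** * Consistent decisions on an uncountable set *)

Section Compactness.

Context {I A : Type} (lt : I -> I -> Prop) (Hwf : well_founded lt)
  (Htrans : forall x y z, lt x y -> lt y z -> lt x z)
  (Htot : forall x y, lt x y \/ x = y \/ lt y x)
  (P : A -> Prop) (HP : ~ countable P) (Q : I -> A -> Prop).

Let decided (chi : I -> Prop) (F : list I) (a : A) : Prop :=
  P a /\ forall j, In j F -> (Q j a <-> chi j).

(** The answer at [i] is positive exactly when this leaves uncountably many points under every
    finite set of earlier decisions. *)
Let choose_step (i : I) (chi : forall j, lt j i -> Prop) : Prop :=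
  forall F, (forall j, In j F -> lt j i) ->
    ~ countable (fun a =>
        (P a /\ forall j (Hj : lt j i), In j F -> (Q j a <-> chi j Hj)) /\ Q i a).

Let chi : I -> Prop := Fix Hwf (fun _ => Prop) choose_step.

Let chi_unfold i : chi i <->
  forall F, (forall j, In j F -> lt j i) ->
    ~ countable (fun a => decided chi F a /\ Q i a).
Proof.
unfold chi at 1. rewrite Fix_eq.
2: { intros x f g H. f_equal. extensionality y. extensionality p. apply H. }
fold chi. unfold choose_step, decided.
split; intros H F HF C; apply (H F HF); apply countable_sub with (2 := C);
  (intros a [[Pa Ha] Qa]; repeat split; auto; apply Ha; auto).
Qed.

(* Transfinite recursion along [lt] takes the place of a uniform ultrafilter
   on [P]: only the sets [Q i] have to be decided. *)
Lemma uniform_decision :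
  exists chi : I -> Prop, forall F : list I,
    ~ countable (fun a => P a /\ forall j, In j F -> (Q j a <-> chi j)).
Proof.
exists chi.
assert (Hstep : forall i,
  (forall F, (forall j, In j F -> lt j i) -> ~ countable (decided chi F)) ->
  forall F, (forall j, In j F -> lt j i \/ j = i) -> ~ countable (decided chi F)).
{ intros i Hi F HF.
  assert (HF' : exists F', (forall j, In j F' -> lt j i) /\
                           (forall j, In j F -> j = i \/ In j F')).
  { clear Hi. induction F as [|k F IH]; [exists []; firstorder |].
    destruct IH as [F' [H1 H2]]; [firstorder |].
    destruct (HF k (or_introl eq_refl)) as [Hk | ->].
    - exists (k :: F'). split; intros j [<- | Hj]; simpl; auto.
      destruct (H2 j Hj); auto.
    - exists F'. split; auto. intros j [<- | Hj]; auto. }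
  destruct HF' as [F' [H1 H2]].
  destruct (classic (chi i)) as [Ci | nCi].
  - intro C. apply (proj1 (chi_unfold i) Ci F' H1).
    apply countable_sub with (2 := C). intros a [[Pa Ha] Qa].
    split; auto. intros j Hj. destruct (H2 j Hj) as [-> | Hj']; [tauto | auto].
  (* A negative answer comes with a finite set [F0] of earlier decisions under which only countably
     many points satisfy [Q i]; the decisions on [F' ++ F0] then hold at uncountably many points
     outside [Q i]. *)
  - assert (N := nCi). rewrite chi_unfold in N.
    apply not_all_ex_not in N. destruct N as [F0 N].
    apply imply_to_and in N. destruct N as [H0 N]. apply NNPP in N.
    intro C.
    assert (HF0 : forall j, In j (F' ++ F0) -> lt j i).
    { intros j Hj. apply in_app_or in Hj. destruct Hj; auto. }
    apply (Hi _ HF0).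
    apply countable_sub with (2 := countable_or _ _ C N).
    intros a [Pa Ha]. destruct (classic (Q i a)) as [Qa | nQa].
    + right. repeat split; auto; intros; apply Ha; auto using in_or_app.
    + left. split; auto. intros j Hj. destruct (H2 j Hj) as [-> | Hj'].
      * tauto.
      * apply Ha. auto using in_or_app. }
assert (Hmax : forall F : list I, F = [] \/
  exists m, In m F /\ forall j, In j F -> lt j m \/ j = m).
{ induction F as [|k F IH]; [now left | right].
  destruct IH as [-> | [m [Hm HF]]].
  - exists k. split; [now left |]. intros j [<- | []]. now right.
  - destruct (Htot k m) as [H | [-> | H]].
    + exists m. split; [now right |]. intros j [<- | Hj]; auto.
    + exists m. split; [now right |]. intros j [<- | Hj]; auto.
    + exists k. split; [now left |]. intros j [<- | Hj]; auto.
      destruct (HF j Hj) as [H' | ->]; eauto. }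
assert (Hnil : ~ countable (decided chi [])).
{ intro C. apply HP. apply countable_sub with (2 := C).
  intros a Pa. split; [easy | intros j []]. }
assert (Hall : forall i F, (forall j, In j F -> lt j i) -> ~ countable (decided chi F)).
{ intro i. induction i as [i IH] using (well_founded_induction Hwf).
  intros F HF. destruct (Hmax F) as [-> | [m [Hm Hj]]]; [exact Hnil |].
  exact (Hstep m (IH m (HF m Hm)) F Hj). }
intro F. destruct (Hmax F) as [-> | [m [Hm Hj]]]; [exact Hnil |].
exact (Hstep m (Hall m) F Hj).
Qed.

End Compactness.

(** * Coherent colourings of a tree *)

Section Tree.

Context {W : Type} (ltW : W -> W -> Prop) (Hw : is_omega1 ltW)
  (U : sporder) (HU : is_tree U) (ht : U -> W) (Hht : is_height ltW U ht).

Lemma ltW_irrefl a : ~ ltW a a.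
Proof. apply Hw. Qed.

Lemma ltW_trans a b c : ltW a b -> ltW b c -> ltW a c.
Proof. apply Hw. Qed.

Lemma ltW_total a b : ltW a b \/ a = b \/ ltW b a.
Proof. apply Hw. Qed.

Lemma ltW_wf : well_founded ltW.
Proof. apply Hw. Qed.

Lemma countable_below a : countable (fun b => ltW b a).
Proof. apply Hw. Qed.

Lemma uncountable_W : ~ countable (fun _ : W => True).
Proof. apply Hw. Qed.

Lemma tlt_trans x y z : tlt U x y -> tlt U y z -> tlt U x z.
Proof. apply HU. Qed.

Lemma tlt_tree x y z : tlt U y x -> tlt U z x -> tlt U y z \/ y = z \/ tlt U z y.
Proof. apply HU. Qed.

Lemma ht_mono x y : tlt U x y -> ltW (ht x) (ht y).
Proof. intro H. now apply Hht. Qed.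

Lemma pred_at x a : ltW a (ht x) -> exists y, tlt U y x /\ ht y = a.
Proof. apply Hht. Qed.

Lemma pred_unique x y z : tlt U y x -> tlt U z x -> ht y = ht z -> y = z.
Proof.
intros Hy Hz E.
destruct (tlt_tree x y z Hy Hz) as [H | [H | H]]; auto;
  apply ht_mono in H; rewrite E in H; now apply ltW_irrefl in H.
Qed.

Lemma countable_pred x : countable (fun y => tlt U y x).
Proof.
destruct (countable_below (ht x)) as [f Hf].
exists (fun y => f (ht y)). intros y z Hy Hz E.
apply (pred_unique x y z Hy Hz). apply Hf; auto using ht_mono.
Qed.

(** The downward closure of an uncountable chain is a branch: a further node of a larger chain would
    lie above all of [B], but it has only countably many predecessors. *)
Lemma countable_chain (B : U -> Prop) :
  (forall C, is_branch U C -> countable C) -> is_chain U B -> countable B.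
Proof.
intros Hbr HB. apply NNPP. intro HN.
set (C x := B x \/ exists y, B y /\ tlt U x y).
apply HN. apply countable_sub with C; [now left |]. apply Hbr. split.
- intros x y [Bx | [x' [Bx Lx]]] [By | [y' [By Ly]]].
  + now apply HB.
  + destruct (HB x y' Bx By) as [H | [-> | H]]; eauto using tlt_tree, tlt_trans.
  + destruct (HB x' y Bx By) as [H | [-> | H]]; eauto using tlt_tree, tlt_trans.
  + destruct (HB x' y' Bx By) as [H | [-> | H]]; eauto using tlt_tree, tlt_trans.
- intros D HD Hsub x Dx. apply NNPP. intro NC. apply HN.
  apply countable_sub with (2 := countable_pred x). intros y By.
  destruct (HD x y Dx (Hsub y (or_introl By))) as [H | [-> | H]]; auto;
    exfalso; apply NC; [right; now exists y | now left].
Qed.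

(** * Finite conditions and their amalgamation *)

Definition dom (p : list (U * nat)) (x : U) : Prop := exists k, In (x, k) p.

Definition lev (p : list (U * nat)) (a : W) : Prop := exists x, dom p x /\ ht x = a.

Definition valid (p : list (U * nat)) : Prop :=
  forall x k y m, In (x, k) p -> In (y, m) p ->
    (x = y -> k = m) /\ (tlt U x y -> k <> m).

(** The case [x = y] also puts every predecessor at a new level into the domain of [q]. *)
Definition extends (q p : list (U * nat)) : Prop :=
  incl p q /\
  forall a, lev q a -> ~ lev p a ->
  forall x y x' y', dom p x -> dom p y -> tlt U x' x -> tlt U y' y ->
    ht x' = a -> ht y' = a -> exists k, In (x', k) q /\ In (y', k) q.

Lemma dom_incl p q x : incl p q -> dom p x -> dom q x.
Proof. intros H [k Hk]. exists k. auto. Qed.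

Lemma extends_refl p : extends p p.
Proof. split; [apply incl_refl | tauto]. Qed.

(** A new level is served by the stage at which it first appears. *)
Lemma extends_trans p q r : extends p q -> extends q r -> extends p r.
Proof.
intros [I1 H1] [I2 H2]. split; [eauto using incl_tran |].
intros a Lp Nr x y x' y' Dx Dy Lx Ly Ex Ey.
destruct (classic (lev q a)) as [Lq | Nq].
- destruct (H2 a Lq Nr x y x' y' Dx Dy Lx Ly Ex Ey) as [k [K1 K2]]. eauto.
- apply (H1 a Lp Nq x y x' y'); eauto using dom_incl.
Qed.

(** Each level receives one fresh colour, larger than all colours of [p]. Comparable nodes lie on
    different levels, so colours stay distinct along chains. *)
Lemma fill p (N : list U) : valid p ->
  exists (r : list (U * nat)) (kappa : W -> nat),
    valid r /\ incl p r /\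
    (forall x, In x N -> ~ dom p x -> In (x, kappa (ht x)) r) /\
    (forall x, dom r x -> dom p x \/ In x N).
Proof.
intro Vp.
destruct (countable_In (map ht N)) as [f Hf].
set (M := S (list_max (map snd p))).
assert (HM : forall x k, In (x, k) p -> k < M).
{ intros x k H. unfold M. apply Nat.lt_succ_r.
  assert (F := proj1 (list_max_le (map snd p) _) (Nat.le_refl _)).
  rewrite Forall_forall in F. apply F. now apply (in_map snd) in H. }
set (new := filter (fun x => if excluded_middle_informative (dom p x)
                             then false else true) N).
assert (Hnew : forall x, In x new <-> In x N /\ ~ dom p x).
{ intro x. unfold new. rewrite filter_In.
  destruct (excluded_middle_informative (dom p x)); intuition congruence. }
set (kappa a := M + f a).
exists (map (fun x => (x, kappa (ht x))) new ++ p), kappa.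
assert (Hr : forall x k, In (x, k) (map (fun x => (x, kappa (ht x))) new ++ p) <->
  (In x new /\ k = kappa (ht x)) \/ In (x, k) p).
{ intros x k. rewrite in_app_iff, in_map_iff. split.
  - intros [[y [E Hy]] | H]; [injection E as -> <-; auto | auto].
  - intros [[Hx ->] | H]; eauto. }
repeat split.
- intros ->. apply Hr in H, H0. destruct H as [[H ->] | H], H0 as [[H0 ->] | H0]; auto.
  + apply Hnew in H. destruct H as [_ H]. exfalso. apply H. now exists m.
  + apply Hnew in H0. destruct H0 as [_ H0]. exfalso. apply H0. now exists k.
  + now apply (Vp y k y m).
- intros Lxy. apply Hr in H, H0. destruct H as [[H ->] | H], H0 as [[H0 ->] | H0].
  + intro E. unfold kappa in E. apply Nat.add_cancel_l in E.
    apply Hnew in H, H0. apply Hf in E; [| apply in_map; tauto ..].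
    apply ht_mono in Lxy. rewrite E in Lxy. now apply ltW_irrefl in Lxy.
  + apply HM in H0. unfold kappa. lia.
  + apply HM in H. unfold kappa. lia.
  + now apply (Vp x k y m).
- apply incl_appr, incl_refl.
- intros x Hx Nx. apply Hr. left. now rewrite Hnew.
- intros x [k Hk]. apply Hr in Hk. rewrite Hnew in Hk.
  destruct Hk as [Hk | Hk]; [tauto | left; now exists k].
Qed.

(** Finiteness holds because a node has at most one predecessor on each level. *)
Lemma preds_at_levels (V : list U) (L : list W) :
  exists N : list U, forall x,
    In x N <-> In (ht x) L /\ exists v, In v V /\ tlt U x v.
Proof.
assert (H1 : forall v a, exists N : list U, forall x,
  In x N <-> ht x = a /\ tlt U x v).
{ intros v a. destruct (classic (exists x, tlt U x v /\ ht x = a)) as [[x [Lx Hx]] | H].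
  - exists [x]. intro y. split.
    + now intros [<- | []].
    + intros [Hy Ly]. left. apply (pred_unique v); congruence.
  - exists []. intro x. split; [easy |]. intros [Hx Lx]. apply H. now exists x. }
assert (H2 : forall v, exists N : list U, forall x,
  In x N <-> In (ht x) L /\ tlt U x v).
{ intro v. induction L as [|a L [N HN]]; [exists []; simpl; tauto |].
  destruct (H1 v a) as [N' HN']. exists (N' ++ N). intro x.
  rewrite in_app_iff, HN, HN'. simpl. intuition congruence. }
induction V as [|v V [N HN]].
- exists []. intro x. split; [easy | now intros [_ [v [[] _]]]].
- destruct (H2 v) as [N' HN']. exists (N' ++ N). intro x.
  rewrite in_app_iff, HN, HN'. split.
  + intros [[Hx Lx] | [Hx [w [Hw' Lx]]]]; (split; [easy |]);
      [exists v | exists w]; simpl; auto.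
  + intros [Hx [w [[<- | Hw'] Lx]]]; [now left | right; eauto].
Qed.

Lemma In_dom p x k : In (x, k) p -> dom p x.
Proof. now exists k. Qed.

Lemma dom_fst p x : dom p x <-> In x (map fst p).
Proof.
unfold dom. rewrite in_map_iff. split.
- intros [k Hk]. now exists (x, k).
- intros [[y k] [<- H]]. now exists k.
Qed.

Lemma lev_list p a : lev p a <-> In a (map ht (map fst p)).
Proof.
rewrite in_map_iff. unfold lev.
split; intros [x [H1 H2]]; exists x; rewrite dom_fst in *; tauto.
Qed.

(** Only the level of [u] can be new, so it suffices to add [u] and the predecessors of the domain
    on that level, in one colour. *)
Lemma extends_dense p u : valid p -> exists q, valid q /\ extends q p /\ dom q u.
Proof.
intro Vp.
destruct (preds_at_levels (map fst p) [ht u]) as [N HN].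
destruct (fill p (u :: N) Vp) as [q [kappa [Vq [Ipq [Hnew Hold]]]]].
exists q. split; [easy |]. split; [split; [easy |] |].
- intros a [z [Dz Hz]] Na x y x' y' Dx Dy Lx Ly Ex Ey.
  assert (Ea : a = ht u).
  { destruct (Hold z Dz) as [Dz' | [<- | Hz']]; auto.
    - exfalso. apply Na. now exists z.
    - destruct (proj1 (HN z) Hz') as [[E | []] _]. congruence. }
  assert (K : forall v v', dom p v -> tlt U v' v -> ht v' = a -> In (v', kappa a) q).
  { intros v v' Dv Lv Ev. rewrite <- Ev. apply Hnew.
    - right. apply HN. split; [left; congruence |]. exists v. now rewrite <- dom_fst.
    - intro D. apply Na. now exists v'. }
  exists (kappa a). eauto.
- destruct (classic (dom p u)) as [D | D]; [eauto using dom_incl |].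
  apply (In_dom _ _ (kappa (ht u))). apply Hnew; [now left | easy].
Qed.

Definition separated (d p q : list (U * nat)) : Prop :=
  forall v x, dom q v -> ~ dom d v -> dom p x -> v <> x /\ ~ tlt U v x.

(** Outside the root no node of one side is comparable with a node of the other, so the union is
    valid. The predecessors still missing on its levels are then coloured level by level. *)
Lemma amalgamate d p q : valid p -> valid q -> incl d p -> incl d q ->
  separated d p q -> separated d q p ->
  exists r, valid r /\ extends r p /\ extends r q.
Proof.
intros Vp Vq Ip Iq Spq Sqp.
assert (V : valid (p ++ q)).
{ assert (cross : forall p q, valid p -> valid q -> incl d p -> incl d q ->
    separated d p q -> separated d q p -> forall x k y m,
    In (x, k) p -> In (y, m) q -> (x = y -> k = m) /\ (tlt U x y -> k <> m)).
  { clear p q Vp Vq Ip Iq Spq Sqp.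
    intros p q Vp Vq Ip Iq Spq Sqp x k y m Hx Hy.
    destruct (classic (dom d y)) as [[m' D] | D].
    - assert (E : m' = m) by (apply (Vq y m' y m); auto). subst m'.
      apply (Vp x k y m); auto.
    - destruct (classic (dom d x)) as [[k' D'] | D'].
      + assert (E : k' = k) by (apply (Vp x k' x k); auto). subst k'.
        apply (Vq x k y m); auto.
      + split.
        * intros ->. exfalso. apply In_dom in Hx, Hy.
          now destruct (Spq y y Hy D Hx).
        * intros L. exfalso. apply In_dom in Hx, Hy.
          now destruct (Sqp x y Hx D' Hy). }
  intros x k y m Hx Hy. apply in_app_or in Hx, Hy.
  destruct Hx as [Hx | Hx], Hy as [Hy | Hy];
    [apply (Vp x k y m) | apply (cross p q) | apply (cross q p) | apply (Vq x k y m)];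
    auto. }
set (L := map ht (map fst (p ++ q))).
destruct (preds_at_levels (map fst (p ++ q)) L) as [N HN].
destruct (fill (p ++ q) N V) as [r [kappa [Vr [Ir [Hnew Hold]]]]].
exists r. split; [easy |].
assert (half : forall p q, separated d p q -> incl d p -> incl (p ++ q) r ->
  (forall x, dom r x -> lev p (ht x) \/ lev q (ht x)) ->
  (forall v x, dom p v -> tlt U x v -> lev q (ht x) -> ~ dom p x -> ~ dom q x ->
     In (x, kappa (ht x)) r) -> extends r p).
{ clear. intros p q S Ip Ir Hold Hnew.
  split; [intros e He; apply Ir, in_or_app; auto |].
  intros a [z [Dz Ez]] Na.
  assert (Lq : lev q a) by (subst a; destruct (Hold z Dz); tauto).
  (* The node [v'] is still uncoloured: its level is new for [p], and a node of [q] outside the root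
     is never below a node of [p]. *)
  assert (K : forall v v', dom p v -> tlt U v' v -> ht v' = a -> In (v', kappa a) r).
  { intros v v' Dv Lv Ev. rewrite <- Ev in *.
    assert (D : ~ dom p v') by (intro D; apply Na; now exists v').
    apply (Hnew v); auto. intro D'.
    destruct (S v' v D') as [_ H]; auto.
    intro D''. apply D. eauto using dom_incl. }
  intros x y x' y' Dx Dy Lx Ly Ex Ey. exists (kappa a). eauto. }
assert (Hlev : forall a, In a L <-> lev p a \/ lev q a).
{ intro a. unfold L. rewrite !map_app, in_app_iff, !lev_list. tauto. }
assert (Hr : forall x, dom r x -> lev p (ht x) \/ lev q (ht x)).
{ intros x Dx. apply Hlev. destruct (Hold x Dx) as [D | Hx]; [| now apply HN].
  apply in_map. now apply dom_fst. }
assert (Hin : forall v x, dom p v \/ dom q v -> tlt U x v ->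
  lev p (ht x) \/ lev q (ht x) -> ~ dom p x -> ~ dom q x -> In (x, kappa (ht x)) r).
{ intros v x Dv Lx Hx Np Nq. apply Hnew.
  - apply HN. split; [now apply Hlev |]. exists v.
    rewrite map_app, in_app_iff, <- !dom_fst. tauto.
  - intros [k Hk]. apply in_app_or in Hk.
    destruct Hk as [Hk | Hk]; apply In_dom in Hk; auto. }
split.
- apply (half p q); eauto.
- apply (half q p); eauto.
  + intros e He. apply Ir. apply in_app_or in He. apply in_or_app. tauto.
  + intros x Dx. destruct (Hr x Dx); auto.
Qed.

(** * The countable chain condition *)

(** Fixing the position in the list is what makes the nodes accepted for that position a chain. *)
Definition below_nth (i : U * nat) (q : list (U * nat)) : Prop :=
  exists y k, nth_error q (snd i) = Some (y, k) /\ tlt U (fst i) y.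

Context (code : U -> W) (Hcode : forall x y, code x = code y -> x = y)
  (Hbr : forall B, is_branch U B -> countable B).

(** A well-order of the questions [below_nth], along which [uniform_decision] answers them. *)
Definition lex (i j : U * nat) : Prop :=
  ltW (code (fst i)) (code (fst j)) \/ (fst i = fst j /\ snd i < snd j).

Lemma lex_wf : well_founded lex.
Proof.
intros [x n]. remember (code x) as a eqn:Ea. revert x Ea n.
induction a as [a IHa] using (well_founded_induction ltW_wf). intros x -> n.
induction n as [n IHn] using lt_wf_ind. constructor. intros [y m] [H | [E H]].
- exact (IHa _ H y eq_refl m).
- simpl in E, H. subst y. now apply IHn.
Qed.

Lemma lex_trans i j k : lex i j -> lex j k -> lex i k.
Proof.
intros [H | [E H]] [H' | [E' H']]; unfold lex; rewrite <- ?E', ?E; auto.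
- left. eauto using ltW_trans.
- right. split; [congruence | lia].
Qed.

Lemma lex_total i j : lex i j \/ i = j \/ lex j i.
Proof.
destruct i as [x n], j as [y m]. unfold lex. simpl.
destruct (ltW_total (code x) (code y)) as [H | [H | H]]; auto.
apply Hcode in H. subst y. destruct (lt_eq_lt_dec n m) as [[H | ->] | H]; auto.
Qed.

(** Given [p], all but countably many [q] have no node outside the root [d] at or below a node of
    [p]; incompatibility then puts a node of [p] outside [d] below a node of [q]. Were this denied
    by [chi] for all such nodes of [p], some [q] would be compatible with [p]. So every [p] has a
    node outside [d] in a countable union of chains, which holds for countably many [p] only. *)
Lemma incompatible_countable {P : Type} (val : P -> list (U * nat)) (A : P -> Prop) :
  (forall p, valid (val p)) ->
  (forall p q, A p -> A q -> p <> q ->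
     ~ exists r, valid r /\ extends r (val p) /\ extends r (val q)) ->
  countable A.
Proof.
intros Hval Hinc. apply NNPP. intro HA.
destruct (root_lemma A val HA) as [d [n [Q [HQ [HQA Hd]]]]].
assert (Hmeet : forall Z : U -> Prop, countable Z ->
  countable (fun q => Q q /\ exists v, Z v /\ ~ dom d v /\ dom (val q) v)).
{ intros Z HZ.
  apply countable_sub with (2 := countable_meeting d Q val (fun e => Z (fst e)) Hd
    (countable_times_nat Z HZ)).
  intros q [Qq [v [Zv [Nv [k Hk]]]]]. split; auto. exists (v, k).
  repeat split; auto. intro H. apply Nv. now exists k. }
assert (Hsep : forall p, Q p ->
  countable (fun q => Q q /\ ~ separated d (val p) (val q))).
{ intros p Qp.
  apply countable_sub with (2 := Hmeet
    (fun v => exists x, dom (val p) x /\ (v = x \/ tlt U v x))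
    (countable_union _ (fun x v => v = x \/ tlt U v x)
      (countable_sub _ _ (fun x => proj1 (dom_fst (val p) x))
         (countable_In (map fst (val p))))
      (fun x _ => countable_or _ _ (countable_eq x) (countable_pred x)))).
  intros q [Qq Nq]. split; auto. apply NNPP. intro H. apply Nq.
  intros v x Dv Nv Dx. split; intro; apply H; exists v; eauto 6. }
destruct (uniform_decision lex lex_wf lex_trans lex_total Q HQ
  (fun i q => below_nth i (val q))) as [chi Hchi].
set (X l x := ~ dom d x /\ chi (x, l)).
(* Two nodes of [X l] lie below the [l]-th node of one and the same [q], hence are comparable. *)
assert (HX : forall l, countable (X l)).
{ intro l. apply countable_chain; [exact Hbr |]. intros x y [_ Cx] [_ Cy].
  destruct (uncountable_inhabited _ (Hchi [(x, l); (y, l)])) as [q [_ Hq]].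
  destruct (proj2 (Hq (x, l) (or_introl eq_refl)) Cx) as [z [k [Hz Lz]]].
  destruct (proj2 (Hq (y, l) (or_intror (or_introl eq_refl))) Cy) as [z' [k' [Hz' Lz']]].
  simpl in *. rewrite Hz in Hz'. injection Hz' as <- <-.
  exact (tlt_tree z x y Lz Lz'). }
apply HQ.
apply countable_sub with (2 := Hmeet (fun x => exists l, True /\ X l x)
  (countable_union (fun _ => True) X (countable_nat _) (fun l _ => HX l))).
intros p Qp. split; auto. apply NNPP. intro HN.
set (F := list_prod (map fst (val p)) (seq 0 n)).
assert (HF : forall x l, dom (val p) x -> l < n -> In (x, l) F).
{ intros x l Dx Ll. apply in_prod; [now apply dom_fst | apply in_seq; lia]. }
apply (uncountable_diff _ (fun q => q = p \/ ~ separated d (val p) (val q)) (Hchi F)).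
{ apply countable_sub with (2 := countable_or _ _ (countable_eq p) (Hsep p Qp)).
  intros q. tauto. }
(* The set is even empty: any member [q] would be compatible with [p]. *)
exists (fun _ => 0). intros q q' [[Qq Hq] Nq] _ _. exfalso.
destruct (HQA p Qp) as [Ap [Ip Lp]], (HQA q Qq) as [Aq [Iq Lq]].
apply (Hinc p q); auto. apply (amalgamate d); auto.
- apply NNPP. tauto.
- intros x y Dx Nx [k Dy]. split.
  + intros ->. apply Nq. right. intro S.
    now destruct (S y y (ex_intro _ k Dy) Nx Dx).
  + intro Lxy. apply In_nth_error in Dy. destruct Dy as [l Hl].
    assert (Ll : l < n) by (rewrite <- Lq; apply nth_error_Some; congruence).
    apply HN. exists x. repeat split; auto. exists l. repeat split; auto.
    apply (Hq (x, l)); auto. now exists y, k.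
Qed.

(** * The generic colouring *)

Lemma coherent_colouring (HMA : MA_omega1 ltW) (enum : W -> U)
  (Henum : forall u, exists a, enum a = u) :
  exists c : U -> nat,
    (forall x y, tlt U x y -> c x <> c y) /\
    (forall u v, exists L : list W, forall x y, tlt U x u -> tlt U y v ->
       ht x = ht y -> ~ In (ht x) L -> c x = c y).
Proof.
set (P := {p | valid p}).
set (le (q p : P) := extends (proj1_sig q) (proj1_sig p)).
destruct (HMA P le) with (D := fun a (p : P) => dom (proj1_sig p) (enum a))
  as [G [[_ [_ Gdir]] GD]].
- constructor. exists []. intros x k y m [].
- intro p. apply extends_refl.
- intros p q r. apply extends_trans.
- intros A HA. apply (incompatible_countable (@proj1_sig _ _)).
  + intros [p Vp]. exact Vp.
  + intros p q Ap Aq N [r [Vr Hr]]. apply (HA p q Ap Aq N).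
    now exists (exist _ r Vr).
- intros a [p Vp]. destruct (extends_dense p (enum a) Vp) as [q [Vq [Hq Dq]]].
  now exists (exist _ q Vq).
- assert (Hc : forall u, exists k, exists p, G p /\ In (u, k) (proj1_sig p)).
  { intro u. destruct (Henum u) as [a <-]. destruct (GD a) as [p [Gp [k Hk]]]. eauto. }
  set (c u := proj1_sig (constructive_indefinite_description _ (Hc u))).
  assert (HcG : forall u, exists p, G p /\ In (u, c u) (proj1_sig p)).
  { intro u. unfold c. now destruct (constructive_indefinite_description _ (Hc u)). }
  assert (Hcp : forall p u k, G p -> In (u, k) (proj1_sig p) -> c u = k).
  { intros p u k Gp Hk. destruct (HcG u) as [q [Gq Hq]].
    destruct (Gdir p q Gp Gq) as [[r Vr] [_ [[Ip _] [Iq _]]]].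
    apply (Vr u (c u) u k); auto. }
  exists c. split.
  + intros x y Lxy. destruct (HcG x) as [p [Gp Hp]], (HcG y) as [q [Gq Hq]].
    destruct (Gdir p q Gp Gq) as [[r Vr] [_ [[Ip _] [Iq _]]]].
    apply (Vr x (c x) y (c y)); auto.
  + intros u v. destruct (HcG u) as [p [Gp Hp]], (HcG v) as [q [Gq Hq]].
    destruct (Gdir p q Gp Gq) as [r [Gr [[Ip _] [Iq _]]]].
    (* The exceptional levels are those of a condition [r] that colours both [u] and [v]. Any other
       level is new over [r], so a stronger condition [t] that colours [x] gives [x] and [y] the
       same colour. *)
    exists (map ht (map fst (proj1_sig r))). intros x y Lx Ly E N.
    destruct (HcG x) as [s [Gs Hs]].
    destruct (Gdir r s Gr Gs) as [t [Gt [[_ Ht] [Is _]]]].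
    destruct (Ht (ht x)) with (x := u) (y := v) (x' := x) (y' := y)
      as [k [K1 K2]]; eauto.
    * exists x. split; auto. exists (c x). auto.
    * now rewrite lev_list.
    * exists (c u). auto.
    * exists (c v). auto.
    * rewrite (Hcp t x k Gt K1). now rewrite (Hcp t y k Gt K2).
Qed.

(** * The tree of traces of a coherent colouring *)

Context (c : U -> nat) (Hspec : forall x y, tlt U x y -> c x <> c y)
  (Hcoh : forall u v, exists L : list W, forall x y, tlt U x u -> tlt U y v ->
     ht x = ht y -> ~ In (ht x) L -> c x = c y).

(* The sequence of colours below [u], as the graph of a function with domain
   the ordinal [ht u]. *)
Definition trace (u : U) (a : W) (k : nat) : Prop :=
  exists x, tlt U x u /\ ht x = a /\ c x = k.

Lemma trace_fun u a k m : trace u a k -> trace u a m -> k = m.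
Proof.
intros [x [Lx [Ex <-]]] [y [Ly [Ey <-]]]. f_equal.
apply (pred_unique u); congruence.
Qed.

Lemma trace_inj u a b k : trace u a k -> trace u b k -> a = b.
Proof.
intros [x [Lx [<- Cx]]] [y [Ly [<- Cy]]]. f_equal.
destruct (tlt_tree u x y Lx Ly) as [H | [H | H]]; auto;
  apply Hspec in H; congruence.
Qed.

Lemma trace_dom u a k : trace u a k -> ltW a (ht u).
Proof. intros [x [Lx [<- _]]]. now apply ht_mono. Qed.

Lemma trace_total u a : ltW a (ht u) -> exists k, trace u a k.
Proof. intro H. destruct (pred_at u a H) as [x [Lx Ex]]. now exists (c x), x. Qed.

Lemma trace_restrict x u a k :
  tlt U x u -> (trace x a k <-> trace u a k /\ ltW a (ht x)).
Proof.
intro Lx. split.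
- intro H. split; [| now apply trace_dom in H].
  destruct H as [y [Ly Hy]]. exists y. split; [now apply tlt_trans with x | easy].
- intros [[y [Ly [<- Cy]]] H]. exists y. split; [| easy].
  destruct (tlt_tree u x y Lx Ly) as [L | [-> | L]]; auto; exfalso.
  + apply ht_mono in L. eapply ltW_irrefl, ltW_trans; eauto.
  + eapply ltW_irrefl; eauto.
Qed.

Lemma trace_ext u v : (forall a k, trace u a k <-> trace v a k) -> trace u = trace v.
Proof.
intro H. extensionality a. extensionality k. apply propositional_extensionality, H.
Qed.

Lemma trace_ht u v : trace u = trace v -> ht u = ht v.
Proof.
intro E. destruct (ltW_total (ht u) (ht v)) as [H | [H | H]]; auto; exfalso.
- destruct (trace_total v _ H) as [k Hk]. rewrite <- E in Hk.
  apply trace_dom in Hk. now apply ltW_irrefl in Hk.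
- destruct (trace_total u _ H) as [k Hk]. rewrite E in Hk.
  apply trace_dom in Hk. now apply ltW_irrefl in Hk.
Qed.

Lemma trace_pred u v x : trace u = trace v -> tlt U x u ->
  exists y, tlt U y v /\ trace y = trace x.
Proof.
intros E Lx. destruct (pred_at v (ht x)) as [y [Ly Ey]].
{ rewrite <- (trace_ht _ _ E). now apply ht_mono. }
exists y. split; auto. apply trace_ext. intros a k.
now rewrite (trace_restrict x u), (trace_restrict y v), E, Ey.
Qed.

(** The node of least [code] stands for all nodes with its trace. *)
Definition is_rep (u : U) : Prop :=
  forall v, trace v = trace u -> ~ ltW (code v) (code u).

Lemma rep_exists u : exists r, is_rep r /\ trace r = trace u.
Proof.
remember (code u) as a eqn:Ea. revert u Ea.
induction a as [a IH] using (well_founded_induction ltW_wf). intros u ->.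
destruct (classic (is_rep u)) as [H | H]; [now exists u |].
apply not_all_ex_not in H. destruct H as [v H].
apply imply_to_and in H. destruct H as [E H]. apply NNPP in H.
destruct (IH _ H v eq_refl) as [r [Hr Er]]. exists r. split; [easy | congruence].
Qed.

Lemma rep_unique u v : is_rep u -> is_rep v -> trace u = trace v -> u = v.
Proof.
intros Hu Hv E. apply Hcode.
destruct (ltW_total (code u) (code v)) as [H | [H | H]]; auto; exfalso.
- now apply (Hv u).
- now apply (Hu v).
Qed.

(* The tree of traces carried by [U] itself: one node per trace is kept as an
   inner node and the others become leaves, so that the tree keeps the
   cardinality and the height function of [U]. *)
Definition traces : sporder :=
  {| node := U;
     tlt u v := is_rep u /\ exists w, tlt U w v /\ trace w = trace u |}.

Lemma traces_ht u v : tlt traces u v -> ltW (ht u) (ht v).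
Proof.
intros [_ [w [Lw Ew]]]. rewrite <- (trace_ht _ _ Ew). now apply ht_mono.
Qed.

Lemma traces_height : is_height ltW traces ht.
Proof.
split.
- intros x y. apply traces_ht.
- intros x a Ha. destruct (pred_at x a Ha) as [y [Ly Ey]].
  destruct (rep_exists y) as [r [Hr Er]]. exists r. split.
  + split; [easy | now exists y].
  + now rewrite (trace_ht _ _ Er).
Qed.

(** Order relations of [U] pass between nodes of equal trace by [trace_pred]; well-foundedness comes
    from the heights. *)
Lemma traces_tree : is_tree traces.
Proof.
split; [| split; [| split]].
- intros x H. apply traces_ht in H. now apply ltW_irrefl in H.
- intros x y z [Rx [x' [Lx Ex]]] [_ [y' [Ly Ey]]]. split; [easy |].
  destruct (trace_pred y y' x' (eq_sym Ey) Lx) as [w [Lw Ew]].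
  exists w. split; [now apply tlt_trans with y' | congruence].
- intros x y z [Ry [y' [Ly Ey]]] [Rz [z' [Lz Ez]]].
  destruct (tlt_tree x y' z' Ly Lz) as [H | [H | H]].
  + left. split; [easy |]. destruct (trace_pred z' z y' Ez H) as [w [Lw Ew]].
    exists w. split; [easy | congruence].
  + right; left. apply rep_unique; [easy | easy | congruence].
  + right; right. split; [easy |]. destruct (trace_pred y' y z' Ey H) as [w [Lw Ew]].
    exists w. split; [easy | congruence].
- intro x. remember (ht x) as a eqn:Ea. revert x Ea.
  induction a as [a IH] using (well_founded_induction ltW_wf). intros x ->.
  constructor. intros y H. apply (IH (ht y)); auto. now apply traces_ht.
Qed.

Lemma traces_sub u v a k : tlt traces u v -> trace u a k -> trace v a k.
Proof.
intros [_ [w [Lw Ew]]] H. rewrite <- Ew in H.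
now apply (trace_restrict w v a k Lw) in H.
Qed.

(* A chain without last element picks up a colour at each of its nodes, and no
   colour is repeated along a chain. *)
Lemma traces_chain (B : traces -> Prop) : is_chain traces B -> countable B.
Proof.
intro HB.
assert (Hlvl : forall x y, B x -> B y -> ht x = ht y -> x = y).
{ intros x y Bx By E.
  destruct (HB x y Bx By) as [H | [H | H]]; auto; apply traces_ht in H;
    rewrite E in H; now apply ltW_irrefl in H. }
(* Code 0 is kept for a last node of [B], so colour [k] is shifted to [S k]. *)
apply countable_rel with (fun v n =>
  (n = 0 /\ forall v', B v' -> ~ tlt traces v v') \/
  (exists k v', n = S k /\ B v' /\ tlt traces v v' /\ trace v' (ht v) k)).
- intros v Bv.
  destruct (classic (exists v', B v' /\ tlt traces v v')) as [[v' [Bv' L]] | N].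
  + destruct (trace_total v' (ht v) (traces_ht _ _ L)) as [k Hk].
    exists (S k). right. now exists k, v'.
  + exists 0. left. split; [easy |]. intros v' Bv' L. apply N. now exists v'.
- intros x y n Bx By [[-> Hx] | [k [x' [-> [Bx' [Lx Tx]]]]]]
    [[E Hy] | [m [y' [E [By' [Ly Ty]]]]]];
    try discriminate E.
  + destruct (HB x y Bx By) as [H | [H | H]]; auto; exfalso;
      [now apply (Hx y) | now apply (Hy x)].
  + injection E as <-. apply Hlvl; auto.
    destruct (HB x' y' Bx' By') as [H | [<- | H]].
    * apply (traces_sub _ _ _ _ H) in Tx. now apply (trace_inj y' _ _ k).
    * now apply (trace_inj x' _ _ k).
    * apply (traces_sub _ _ _ _ H) in Ty. now apply (trace_inj x' _ _ k).
Qed.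

(** By coherence the traces can differ only on a finite list of levels; the bound on heights gives
    [v] a predecessor on every level where [u] has one. *)
Lemma trace_diff u v : ~ ltW (ht v) (ht u) ->
  exists E : list (W * nat), forall a k,
    In (a, k) E <-> trace u a k /\ ~ trace v a k.
Proof.
intro Huv. destruct (Hcoh u v) as [L HL].
destruct (preds_at_levels [u] L) as [N HN].
exists (map (fun x => (ht x, c x))
  (filter (fun x => if excluded_middle_informative (trace v (ht x) (c x))
                    then false else true) N)).
intros a k. rewrite in_map_iff. split.
- intros [x [E Hx]]. injection E as <- <-. apply filter_In in Hx.
  destruct (excluded_middle_informative (trace v (ht x) (c x))) as [T | T];
    [easy |]. split; [| easy].
  destruct Hx as [Hx _]. apply HN in Hx.
  destruct Hx as [_ [w [[<- | []] Lx]]]. now exists x.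
- intros [[x [Lx [<- <-]]] T]. exists x. split; [easy |]. apply filter_In.
  destruct (excluded_middle_informative (trace v (ht x) (c x))); [easy |].
  split; [| easy]. apply HN. split; [| exists u; simpl; auto].
  apply NNPP. intro NL. apply T.
  assert (H : ltW (ht x) (ht v)).
  { apply ht_mono in Lx.
    destruct (ltW_total (ht u) (ht v)) as [H | [H | H]];
      [eauto using ltW_trans | congruence | easy]. }
  destruct (pred_at v _ H) as [y [Ly Ey]]. exists y. repeat split; auto.
  symmetry. auto.
Qed.

(** If two traces never disagree, one is a restriction of the other, so that their representatives
    are comparable or equal. Otherwise well-foundedness yields a first disagreement. *)
Lemma traces_split s s' : is_rep s -> is_rep s' ->
  ~ (tlt traces s s' \/ s = s' \/ tlt traces s' s) ->
  exists a k k', trace s a k /\ trace s' a k' /\ k <> k' /\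
    forall b m, ltW b a -> (trace s b m <-> trace s' b m).
Proof.
intros Rs Rs' Hinc.
assert (cmp : forall s s', is_rep s -> ~ ltW (ht s') (ht s) ->
  (forall a k k', trace s a k -> trace s' a k' -> k = k') ->
  tlt traces s s' \/ trace s = trace s').
{ clear s s' Rs Rs' Hinc. intros s s' Rs Hs Heq.
  assert (H : forall x, ht x = ht s -> (forall a m, trace x a m -> trace s' a m) ->
    trace x = trace s).
  { intros x Ex Hx. apply trace_ext. intros a m. split; intro T.
    - destruct (trace_total s a) as [k Tk].
      + rewrite <- Ex. now apply trace_dom in T.
      + now rewrite <- (Heq a k m Tk (Hx a m T)).
    - destruct (trace_total x a) as [k Tk].
      + rewrite Ex. now apply trace_dom in T.
      + now rewrite (Heq a m k T (Hx a k Tk)). }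
  destruct (ltW_total (ht s) (ht s')) as [L | [L | L]]; [| | easy].
  - left. split; [easy |]. destruct (pred_at s' (ht s) L) as [x [Lx Ex]].
    exists x. split; [easy |]. apply H; [easy |].
    intros a m T. now apply (trace_restrict x s').
  - right. symmetry. now apply H. }
assert (Hex : exists a, exists k k', trace s a k /\ trace s' a k' /\ k <> k').
{ apply NNPP. intro N. apply Hinc.
  assert (Heq : forall a k k', trace s a k -> trace s' a k' -> k = k').
  { intros a k k' T T'. apply NNPP. intro. apply N. now exists a, k, k'. }
  destruct (classic (ltW (ht s') (ht s))) as [H | H].
  - destruct (cmp s' s) as [C | C]; auto.
    + intro H'. eapply ltW_irrefl, ltW_trans; eauto.
    + intros a k k' T T'. symmetry. eauto.
    + right; left. now apply rep_unique.
  - destruct (cmp s s') as [C | C]; auto.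
    right; left. now apply rep_unique. }
destruct Hex as [a Ha]. revert Ha.
induction a as [a IH] using (well_founded_induction ltW_wf). intro Ha.
destruct (classic (exists b, ltW b a /\
  exists k k', trace s b k /\ trace s' b k' /\ k <> k')) as [[b [Lb Hb]] | N].
- exact (IH b Lb Hb).
- destruct Ha as [k [k' [T [T' D]]]]. exists a, k, k'. repeat split; auto.
  + intro Tm. destruct (trace_total s' b) as [m' Tm'].
    { apply ltW_trans with a; [easy | now apply trace_dom in T']. }
    replace m with m'; [easy |]. apply NNPP. intro Nm. apply N.
    exists b. split; [easy |]. exists m, m'. auto.
  + intro Tm. destruct (trace_total s b) as [m' Tm'].
    { apply ltW_trans with a; [easy | now apply trace_dom in T]. }
    replace m with m'; [easy |]. apply NNPP. intro Nm. apply N.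
    exists b. split; [easy |]. exists m', m. auto.
Qed.

(** * The tree of traces does not embed into the given tree *)

Context (u_ : W -> U) (Hu : forall a, ht (u_ a) = a).

(** A trace of length [a] is a finite modification of the trace of [u_ a], so a pigeonhole argument
    applies: [root_lemma] makes uncountably many of the differences [E b] coincide. *)
Lemma big_node (Q : W -> Prop) (a : W) : ~ countable Q ->
  exists s, is_rep s /\ ht s = a /\
    ~ countable (fun b => Q b /\ tlt traces s (u_ b)).
Proof.
intro HQ.
assert (HQa : ~ countable (fun b => Q b /\ ~ (ltW b a \/ b = a))).
{ apply uncountable_diff; [easy |].
  apply countable_sub with (2 := countable_or _ _ (countable_below a) (countable_eq a)).
  tauto. }
assert (Hsel : forall b, exists y, ltW a b -> tlt U y (u_ b) /\ ht y = a).
{ intro b. destruct (classic (ltW a b)) as [H | H]; [| now exists (u_ b)].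
  rewrite <- (Hu b) in H. destruct (pred_at _ _ H) as [y Hy]. now exists y. }
set (y_ b := proj1_sig (constructive_indefinite_description _ (Hsel b))).
assert (Hy : forall b, ltW a b -> tlt U (y_ b) (u_ b) /\ ht (y_ b) = a).
{ intro b. unfold y_.
  now destruct (constructive_indefinite_description _ (Hsel b)). }
clearbody y_.
assert (HE : forall b, exists E : list (W * nat), ltW a b -> forall e m,
  In (e, m) E <-> trace (y_ b) e m /\ ~ trace (u_ a) e m).
{ intro b. destruct (classic (ltW a b)) as [H | H]; [| now exists []].
  destruct (trace_diff (y_ b) (u_ a)) as [E HE].
  - rewrite Hu. destruct (Hy b H) as [_ ->]. apply ltW_irrefl.
  - now exists E. }
set (E b := proj1_sig (constructive_indefinite_description _ (HE b))).
assert (HEs : forall b, ltW a b -> forall e m,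
  In (e, m) (E b) <-> trace (y_ b) e m /\ ~ trace (u_ a) e m).
{ intro b. unfold E.
  now destruct (constructive_indefinite_description _ (HE b)). }
clearbody E. clear HE Hsel.
destruct (root_lemma _ E HQa) as [d [n [Q' [HQ' [HQE Hd]]]]].
assert (Hab : forall b, Q' b -> Q b /\ ltW a b).
{ intros b Qb. destruct (HQE b Qb) as [[Hb Nb] _]. split; [easy |].
  destruct (ltW_total a b) as [H | [H | H]]; auto; exfalso; apply Nb; auto. }
(* The entries of [E b] lie on levels below [a], which leaves countably many possible entries; so
   uncountably many [b] have no entry outside [d]. *)
assert (HR := uncountable_diff _ _ HQ' (countable_meeting d Q' E
  (fun e => ltW (fst e) a) Hd (countable_times_nat _ (countable_below a)))).
assert (Heq : forall b, Q' b /\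
    ~ (exists e, ltW (fst e) a /\ ~ In e d /\ In e (E b)) ->
  forall e m, In (e, m) (E b) <-> In (e, m) d).
{ intros b [Qb Nb] e m. split; [| apply (HQE b Qb)].
  intro H. apply NNPP. intro N. apply Nb. exists (e, m).
  repeat split; auto. destruct (Hab b Qb) as [_ Lb].
  apply (HEs b Lb) in H. destruct H as [H _]. apply trace_dom in H.
  now destruct (Hy b Lb) as [_ <-]. }
(* Where [y_ b] agrees with [u_ a], a different value of [y_ b'] would be an entry of [E b'], hence
   of [E b], and thus a second value of [y_ b]. *)
assert (Hsub : forall b b', ltW a b -> ltW a b' ->
  (forall e m, In (e, m) (E b) <-> In (e, m) (E b')) ->
  forall e m, trace (y_ b) e m -> trace (y_ b') e m).
{ intros b b' Lb Lb' H e m T.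
  destruct (classic (trace (u_ a) e m)) as [Tu | Nu].
  - destruct (trace_total (y_ b') e) as [m' T'].
    { destruct (Hy b' Lb') as [_ ->]. destruct (Hy b Lb) as [_ <-].
      now apply trace_dom in T. }
    destruct (classic (trace (u_ a) e m')) as [Tu' | Nu'].
    + now rewrite (trace_fun _ _ _ _ Tu Tu').
    + exfalso. assert (I : In (e, m') (E b)) by now apply H, HEs.
      apply HEs in I; auto. destruct I as [I _].
      apply Nu'. now rewrite (trace_fun _ _ _ _ I T).
  - assert (I : In (e, m) (E b')) by now apply H, HEs.
    now apply HEs in I. }
destruct (uncountable_inhabited _ HR) as [b0 Hb0].
destruct (rep_exists (y_ b0)) as [s [Rs Es]].
destruct (Hab b0 (proj1 Hb0)) as [_ L0].
exists s. split; [easy |]. split.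
- rewrite (trace_ht _ _ Es). now apply Hy.
- intro C. apply HR. apply countable_sub with (2 := C). intros b Hb.
  destruct (Hab b (proj1 Hb)) as [Qb Lb]. split; [easy |]. split; [easy |].
  exists (y_ b). split; [now apply Hy |]. rewrite Es.
  assert (EE : forall e m, In (e, m) (E b) <-> In (e, m) (E b0)).
  { intros e m. now rewrite (Heq b Hb), (Heq b0 Hb0). }
  apply trace_ext. intros e m. split; apply Hsub; auto.
  intros; symmetry; apply EE.
Qed.

(** From a node [u] sent to a lower height, its predecessor at height [ht (f u)] is another such
    node, since its image is strictly below [f u]; this descent cannot go on. *)
Lemma embedding_raises (f : traces -> U) : weak_embedding traces U f ->
  forall u, ~ ltW (ht (f u)) (ht u).
Proof.
intros Hf u. remember (ht u) as a eqn:Ea. revert u Ea.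
induction a as [a IH] using (well_founded_induction ltW_wf). intros u -> H.
destruct (proj2 traces_height u _ H) as [t [Lt Et]].
apply (IH _ H t (eq_sym Et)). apply ht_mono. now apply Hf.
Qed.

Lemma traces_not_below : ~ weakly_embeds traces U.
Proof.
intros [f Hf].
assert (Hz := fun a => embedding_raises f Hf (u_ a)).
set (z_ a := f (u_ a)).
set (E a := proj1_sig (constructive_indefinite_description _
  (trace_diff (u_ a) (z_ a) (Hz a)))).
assert (HE : forall a b k, In (b, k) (E a) <->
  trace (u_ a) b k /\ ~ trace (z_ a) b k).
{ intro a. unfold E. now destruct (constructive_indefinite_description _
    (trace_diff (u_ a) (z_ a) (Hz a))). }
clearbody E.
destruct (root_lemma _ E uncountable_W) as [d [n [Q [HQ [HQE Hd]]]]].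
set (big s := is_rep s /\ ~ countable (fun b => Q b /\ tlt traces s (u_ b))).
assert (Hchain : is_chain traces big).
{ intros s s' [Rs Bs] [Rs' Bs']. apply NNPP. intro N.
  destruct (traces_split s s' Rs Rs' N) as [x [k [k' [Tk [Tk' [Dk Hx]]]]]].
  (* Discarding countably many indices leaves one for which [E a] and the root [d] have the same
     entries at [x]. *)
  assert (sel : forall s k, ~ countable (fun b => Q b /\ tlt traces s (u_ b)) ->
    trace s x k -> exists a, Q a /\ tlt traces s (u_ a) /\ trace (u_ a) x k /\
      forall m, In (x, m) (E a) <-> In (x, m) d).
  { clear s s' k k' Rs Bs Rs' Bs' N Tk Tk' Dk Hx. intros s k Bs Tk.
    destruct (uncountable_inhabited _ (uncountable_diff _
      (fun a => exists e, fst e = x /\ ~ In e d /\ In e (E a)) Bs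
      (countable_sub _ _ (fun a H => conj (proj1 (proj1 H)) (proj2 H))
        (countable_meeting d Q E (fun e => fst e = x) Hd
          (countable_times_nat _ (countable_eq x)))))) as [a [[Qa La] Na]].
    exists a. split; [easy |]. split; [easy |].
    split; [now apply (traces_sub s) |]. intro m. split.
    - intro I. apply NNPP. intro Nd. apply Na. now exists (x, m).
    - apply (HQE a Qa). }
  destruct (sel s k Bs Tk) as [a [Qa [La [Ta Ea]]]].
  destruct (sel s' k' Bs' Tk') as [a' [Qa' [La' [Ta' Ea']]]].
  (* Otherwise [(x, k)] would be an entry of [E a], hence of the root and of [E a'], and [u_ a']
     would have both colours [k] and [k'] at [x]. *)
  assert (Za : trace (z_ a) x k).
  { apply NNPP. intro Nz. apply Dk.
    assert (I : In (x, k) (E a')) by now apply Ea', Ea, HE.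
    apply HE in I. now apply (trace_fun (u_ a') x). }
  assert (Za' : trace (z_ a') x k').
  { apply NNPP. intro Nz. apply Dk.
    assert (I : In (x, k') (E a)) by now apply Ea, Ea', HE.
    apply HE in I. now apply (trace_fun (u_ a) x). }
  (* The common restriction of both traces to [x] is the trace of a node. *)
  assert (Hr : exists r, ht r = x /\ tlt traces r (u_ a) /\ tlt traces r (u_ a')).
  { assert (Lx := trace_dom _ _ _ Tk). assert (Lx' := trace_dom _ _ _ Tk').
    destruct (pred_at s x Lx) as [w [Lw Ew]].
    destruct (pred_at s' x Lx') as [w' [Lw' Ew']].
    destruct (rep_exists w) as [r [Rr Er]].
    assert (Ew2 : trace w' = trace w).
    { apply trace_ext. intros b m. rewrite (trace_restrict w s), (trace_restrict w' s')
        by easy. rewrite Ew, Ew'. split; intros [T L]; split; auto; now apply (Hx b m L). }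
    exists r. split; [now rewrite (trace_ht _ _ Er) |].
    split; (apply (proj1 (proj2 traces_tree)) with (2 := La) ||
            apply (proj1 (proj2 traces_tree)) with (2 := La'));
      (split; [easy |]); [exists w | exists w']; split; congruence. }
  destruct Hr as [r [Er [Lr Lr']]].
  apply Hf in Lr, Lr'. fold (z_ a) in Lr. fold (z_ a') in Lr'.
  assert (Hge := embedding_raises f Hf r). rewrite Er in Hge.
  apply Dk.
  destruct Za as [v [Lv [Ev <-]]], Za' as [v' [Lv' [Ev' <-]]]. f_equal.
  (* The node [f r] lies below [z_ a] and [z_ a'] and has height at least [x], so the two share
     their predecessor at [x]. *)
  destruct (ltW_total x (ht (f r))) as [H | [H | H]]; [| | easy].
  - destruct (pred_at _ _ H) as [y [Ly Ey]]. transitivity y.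
    + apply (pred_unique (z_ a)); eauto using tlt_trans. congruence.
    + apply (pred_unique (z_ a')); eauto using tlt_trans. congruence.
  - transitivity (f r).
    + apply (pred_unique (z_ a)); auto. congruence.
    + apply (pred_unique (z_ a')); auto. congruence. }
(* The chain [big] is countable, yet by [big_node] it has a node at every height. *)
apply uncountable_W.
apply countable_sub with (2 := countable_union big (fun s b => b = ht s)
  (traces_chain big Hchain) (fun s _ => countable_eq (ht s))).
intros a _. destruct (big_node Q a HQ) as [s [Rs [Hs Cs]]].
exists s. split; [now split | easy].
Qed.

End Tree.

Theorem theorem6p1 (W : Type) (ltW : W -> W -> Prop)
  (Hw : is_omega1 ltW) (HMA : MA_omega1 ltW) :
  ~ (exists U : sporder, wide_aronszajn ltW U /\
       forall T : sporder, wide_aronszajn ltW T -> weakly_embeds T U).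
Proof.
intros [U [[HU [[ht [Hht Hsurj]] [[code [Hcode Hcodes]] Hbr]]] Huniv]].
set (choose_fibre (g : U -> W) (Hg : forall a, exists x, g x = a) a :=
  constructive_indefinite_description _ (Hg a)).
destruct (coherent_colouring ltW Hw U HU ht Hht code Hcode Hbr HMA
  (fun a => proj1_sig (choose_fibre code Hcodes a))) as [c [Hspec Hcoh]].
{ intro u. exists (code u). apply Hcode. exact (proj2_sig (choose_fibre _ Hcodes _)). }
apply (traces_not_below ltW Hw U HU ht Hht code Hcode c Hspec Hcoh
  (fun a => proj1_sig (choose_fibre ht Hsurj a))
  (fun a => proj2_sig (choose_fibre ht Hsurj a))).
(* The tree of traces has the nodes and heights of [U], so [ht] and [code] serve again. *)
apply Huniv. split; [| split; [| split]].
- eapply traces_tree; eassumption.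
- exists ht. split; [eapply traces_height; eassumption | easy].
- now exists code.
- intros B [HB _]. eapply traces_chain; eassumption.
Qed.
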